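(* Let $a=(a_1,\dots,a_n)$ be a tuple of distinct complex numbers. For any $k,l\in\mathbb{N}$, $m\in\mathbb{Z}$ and $i\ne j$ in $\{1,\dots,n\}$, the following hold in $\mathscr{V}_a$: (a) $$[(t-a_i)^{k}\partial,(t-a_j)^{m}\partial]=\sum_{s=0}^{k}\binom{k}{s}(m+s-k)(a_j-a_i)^s(t-a_j)^{k+m-s-1}\partial;$$ (b) $$[(t-a_i)^{-k}\partial,(t-a_j)^{-l}\partial]=\sum_{m=1}^{k+1}(2k+1-m)\binom{k+l-m}{k+1-m}\frac{(t-a_i)^{-m}}{(a_i-a_j)^l(a_j-a_i)^{k+1-m}}\partial-\sum_{m=1}^{l+1}(2l+1-m)\binom{l+k-m}{l+1-m}\frac{(t-a_j)^{-m}}{(a_j-a_i)^k(a_i-a_j)^{l+1-m}}\partial.$$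
   Context: $\mathbb{N}=\{1,2,\dots\}$. $R_a$ is the subalgebra of $\mathbb{C}(t)$ generated by $t,(t-a_1)^{-1},\dots,(t-a_n)^{-1}$, and $\mathscr{V}_a=\operatorname{Der}(R_a)=R_a\partial$ with $\partial=d/dt$, a Lie algebra with bracket $[f\partial,g\partial]=(f\partial(g)-g\partial(f))\partial$. *)

(* Defs.v *)
From HB Require Import structures.
From mathcomp Require Import all_boot all_order all_algebra.
From mathcomp Require Import generic_quotient fraction.
From mathcomp Require Import ring.
From mathcomp Require Import boolp functions reals complex.

Set Implicit Arguments.
Unset Strict Implicit.
Unset Printing Implicit Defensive.
Import GRing.Theory.
Local Open Scope ring_scope.
Local Open Scope quotient_scope.

Section GeneratedSubalgebra.
Variables (F : comNzRingType) (A : algType F).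

Inductive in_subalg (S : A -> Prop) : A -> Prop :=
| subalg_gen x : S x -> in_subalg S x
| subalg_one : in_subalg S 1
| subalg_lin c x y : in_subalg S x -> in_subalg S y -> in_subalg S (c *: x + y)
| subalg_mul x y : in_subalg S x -> in_subalg S y -> in_subalg S (x * y).

Definition subalg (S : A -> Prop) : pred A := fun x => `[< in_subalg S x >].

Lemma subalgP S x : reflect (in_subalg S x) (x \in subalg S).
Proof. exact: asboolP. Qed.

Lemma subalg_closed S : GRing.subalg_closed (subalg S).
Proof.
split=> [|c x y /subalgP Sx /subalgP Sy|x y /subalgP Sx /subalgP Sy];
  apply/subalgP; by [exact: subalg_one|exact: subalg_lin|exact: subalg_mul].
Qed.

HB.instance Definition _ S :=
  GRing.isSubalgClosed.Build F A (subalg S) (subalg_closed S).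

End GeneratedSubalgebra.

Definition ratfun (F : fieldType) : Type := {fraction {poly F}}.

Section QuotientRule.
Variable L : fieldType.
Implicit Types p q r s : L.

Fact quot_deriv_wd p q n d p' q' n' d' : q != 0 -> d != 0 ->
    p * d = n * q -> p' * d + p * d' = n' * q + n * q' ->
  (n' * d - n * d') / d ^+ 2 = (p' * q - p * q') / q ^+ 2.
Proof.
move=> q0 d0 e1 e2; apply/eqP; rewrite eqr_div ?expf_neq0 //; apply/eqP.
have -> : (n' * d - n * d') * q ^+ 2 =
  (n' * q + n * q') * (d * q) - (n * q) * (d * q' + q * d') by ring.
by rewrite -e1 -e2; ring.
Qed.

Fact quot_derivM p q r s p' q' r' s' : q != 0 -> s != 0 ->
  ((p' * r + p * r') * (q * s) - p * r * (q' * s + q * s')) / (q * s) ^+ 2 =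
  (p' * q - p * q') / q ^+ 2 * (r / s) + p / q * ((r' * s - r * s') / s ^+ 2).
Proof. by move=> q0 s0; field; rewrite q0 s0. Qed.

Fact quot_derivP c p q r s p' q' r' s' : q != 0 -> s != 0 ->
  ((c * p' * s + c * p * s' + (r' * q + r * q')) * (q * s)
    - (c * p * s + r * q) * (q' * s + q * s')) / (q * s) ^+ 2 =
  c * ((p' * q - p * q') / q ^+ 2) + (r' * s - r * s') / s ^+ 2.
Proof. by move=> q0 s0; field; rewrite q0 s0. Qed.

Fact deriv_inv (x x' y' : L) : x != 0 -> x' * x^-1 + x * y' = 0 ->
  y' = - x' * x^-1 ^+ 2.
Proof.
move=> x0 /eqP; rewrite addrC addr_eq0 => /eqP e.
by apply: (mulfI x0); rewrite e; field.
Qed.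

End QuotientRule.

Section RatFun.
Variable F : fieldType.
Local Notation K := (ratfun F).
Implicit Types (p q : {poly F}) (x y : K).

HB.instance Definition _ := GRing.Field.on K.

Definition ratfun_of_poly p : K := FracField.tofrac p.
HB.instance Definition _ :=
  GRing.RMorphism.copy ratfun_of_poly (@FracField.tofrac {poly F}).

Definition ratfun_scale (c : F) (x : K) : K := ratfun_of_poly c%:P * x.

Fact ratfun_scaleA c d x :
  ratfun_scale c (ratfun_scale d x) = ratfun_scale (c * d) x.
Proof. by rewrite /ratfun_scale mulrA -rmorphM -polyCM. Qed.
Fact ratfun_scale1 : left_id 1 ratfun_scale.
Proof. by move=> x; rewrite /ratfun_scale polyC1 rmorph1 mul1r. Qed.
Fact ratfun_scaleDr : right_distributive ratfun_scale +%R.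
Proof. by move=> c x y; rewrite /ratfun_scale mulrDr. Qed.
Fact ratfun_scaleDl x : {morph ratfun_scale^~ x : c d / c + d}.
Proof. by move=> c d; rewrite /ratfun_scale polyCD rmorphD mulrDl. Qed.
HB.instance Definition _ := GRing.Zmodule_isLmodule.Build F K
  ratfun_scaleA ratfun_scale1 ratfun_scaleDr ratfun_scaleDl.

Fact ratfun_scaleAl c (x y : K) : c *: (x * y) = (c *: x) * y.
Proof. exact: mulrA. Qed.
HB.instance Definition _ := GRing.Lmodule_isLalgebra.Build F K ratfun_scaleAl.
HB.instance Definition _ := GRing.Lalgebra_isComAlgebra.Build F K.

Lemma ratfun_scaleE c (x : K) : c *: x = ratfun_of_poly c%:P * x.
Proof. by []. Qed.

Lemma ratfun_of_poly_eq0 p : (ratfun_of_poly p == 0) = (p == 0).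
Proof. exact: tofrac_eq0. Qed.

Definition ratfun_num (x : K) : {poly F} := \n_(repr (x : {fraction {poly F}})).
Definition ratfun_den (x : K) : {poly F} := \d_(repr (x : {fraction {poly F}})).

Lemma ratfun_den_neq0 x : ratfun_den x != 0.
Proof. exact: denom_ratioP. Qed.

Lemma ratfun_numdenE x :
  x = ratfun_of_poly (ratfun_num x) / ratfun_of_poly (ratfun_den x).
Proof.
have d0 : ratfun_of_poly (ratfun_den x) != 0.
  by rewrite ratfun_of_poly_eq0 ratfun_den_neq0.
apply: (mulfI d0); rewrite [RHS]mulrC mulfVK //.
rewrite /ratfun_den /ratfun_num /ratfun_of_poly.
set r := repr _; have -> : x = \pi_{fraction {poly F}} r by rewrite reprK.
rewrite -[LHS]/(FracField.mul _ _) !piE.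
apply/eqmodP; rewrite /= FracField.equivfE /FracField.mulf.
by rewrite !numden_Ratio ?mulf_neq0 ?oner_neq0 ?denom_ratioP // mulr1 mul1r.
Qed.

(* d/dt, by the quotient rule on the representative of x chosen by [repr];
   ratfun_deriv_frac shows independence of that choice. *)
Definition ratfun_deriv (x : K) : K :=
  let p := ratfun_num x in let q := ratfun_den x in
  ratfun_of_poly (p^`() * q - p * q^`()) / ratfun_of_poly q ^+ 2.

Lemma ratfun_deriv_frac p q : q != 0 ->
  ratfun_deriv (ratfun_of_poly p / ratfun_of_poly q) =
  ratfun_of_poly (p^`() * q - p * q^`()) / ratfun_of_poly q ^+ 2.
Proof.
move=> q0; set x := _ / _; rewrite /ratfun_deriv.
have := ratfun_numdenE x; have := ratfun_den_neq0 x.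
move: (ratfun_num x) (ratfun_den x) => n d d0; rewrite {}/x => E.
have q0' : ratfun_of_poly q != 0 by rewrite ratfun_of_poly_eq0.
have d0' : ratfun_of_poly d != 0 by rewrite ratfun_of_poly_eq0.
have pd : p * d = n * q.
  move/eqP: E; rewrite (eqr_div _ _ q0' d0') -!rmorphM -subr_eq0 -rmorphB.
  by rewrite ratfun_of_poly_eq0 subr_eq0 => /eqP.
rewrite !rmorphB !rmorphM; apply: quot_deriv_wd q0' d0' _ _.
  by rewrite -!rmorphM pd.
by rewrite -!rmorphM -!rmorphD -!derivM pd.
Qed.

Lemma ratfun_deriv_poly p : ratfun_deriv (ratfun_of_poly p) = ratfun_of_poly p^`().
Proof.
have := @ratfun_deriv_frac p 1 (oner_neq0 _).
by rewrite rmorph1 divr1 expr1n divr1 derivC mulr1 mulr0 subr0.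
Qed.

Lemma ratfun_derivM x y :
  ratfun_deriv (x * y) = ratfun_deriv x * y + x * ratfun_deriv y.
Proof.
rewrite [x]ratfun_numdenE [y]ratfun_numdenE.
have := ratfun_den_neq0 x; have := ratfun_den_neq0 y.
move: (ratfun_num x) (ratfun_den x) (ratfun_num y) (ratfun_den y).
move=> p q r s s0 q0; rewrite mulf_div -!rmorphM.
rewrite (ratfun_deriv_frac _ (mulf_neq0 q0 s0)) (ratfun_deriv_frac _ q0).
rewrite (ratfun_deriv_frac _ s0).
have q0' : ratfun_of_poly q != 0 by rewrite ratfun_of_poly_eq0.
have s0' : ratfun_of_poly s != 0 by rewrite ratfun_of_poly_eq0.
rewrite !derivM !(rmorphB, rmorphD, rmorphM) /=; exact: quot_derivM q0' s0'.
Qed.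

Lemma ratfun_deriv_is_linear : linear ratfun_deriv.
Proof.
move=> c x y; rewrite !ratfun_scaleE.
rewrite [x in ratfun_of_poly _ * x + _]ratfun_numdenE [x in RHS]ratfun_numdenE.
rewrite [y]ratfun_numdenE.
have := ratfun_den_neq0 x; have := ratfun_den_neq0 y.
move: (ratfun_num x) (ratfun_den x) (ratfun_num y) (ratfun_den y).
move=> p q r s s0 q0.
have q0' : ratfun_of_poly q != 0 by rewrite ratfun_of_poly_eq0.
have s0' : ratfun_of_poly s != 0 by rewrite ratfun_of_poly_eq0.
rewrite mulrA (addf_div _ _ q0' s0') -!rmorphM -rmorphD.
rewrite (ratfun_deriv_frac _ (mulf_neq0 q0 s0)) (ratfun_deriv_frac _ q0).
rewrite (ratfun_deriv_frac _ s0).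
rewrite !(derivM, derivD, derivC) mul0r add0r !(rmorphB, rmorphD, rmorphM) /=.
exact: quot_derivP q0' s0'.
Qed.
HB.instance Definition _ :=
  GRing.isLinear.Build F K K *:%R ratfun_deriv ratfun_deriv_is_linear.

Lemma ratfun_derivV x : ratfun_deriv x^-1 = - ratfun_deriv x * x^-1 ^+ 2.
Proof.
have [->|x0] := eqVneq x 0; first by rewrite invr0 linear0 oppr0 mul0r.
have := ratfun_derivM x x^-1; rewrite divff //.
have -> : ratfun_deriv 1 = 0.
  by rewrite -(rmorph1 ratfun_of_poly) ratfun_deriv_poly derivC rmorph0.
by move/esym/(deriv_inv x0).
Qed.

End RatFun.

Section Derivations.
Variables (F : comNzRingType) (A : comAlgType F).

Definition is_derivation (D : A -> A) : bool :=
  `[< linear D /\ forall x y, D (x * y) = D x * y + x * D y >].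

Record Der := MkDer { Der_fun :> A -> A; _ : is_derivation Der_fun }.

HB.instance Definition _ := [isSub for Der_fun].
HB.instance Definition _ := [Choice of Der by <:].

Lemma DerP (D E : Der) : (forall x, D x = E x) -> D = E.
Proof. by move=> DE; apply: val_inj; apply: funext. Qed.

Fact Der_linear (D : Der) : linear D.
Proof. by case: D => D DP; have /asboolP[] := DP. Qed.
HB.instance Definition _ (D : Der) :=
  GRing.isLinear.Build F A A *:%R (Der_fun D) (Der_linear D).

Lemma DerM (D : Der) x y : D (x * y) = D x * y + x * D y.
Proof. by case: D => D /= DP; have /asboolP[_] := DP; apply. Qed.

Lemma DerD (D : Der) x y : D (x + y) = D x + D y.
Proof. exact: (raddfD D). Qed.

Lemma DerB (D : Der) x y : D (x - y) = D x - D y.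
Proof. exact: (raddfB D). Qed.

Lemma DerZ (D : Der) c x : D (c *: x) = c *: D x.
Proof. exact: (linearZZ D). Qed.

Lemma Der1 (D : Der) : D 1 = 0.
Proof.
have := DerM D 1 1; rewrite !mulr1 mul1r => /eqP.
by rewrite -subr_eq0 opprD addNKr oppr_eq0 => /eqP.
Qed.

Fact is_derivation_zmod : zmod_closed is_derivation.
Proof.
split=> [|D E /asboolP[lD mD] /asboolP[lE mE]]; apply/asboolP; split.
- by move=> c x y /=; rewrite scaler0 addr0.
- by move=> x y /=; rewrite mul0r mulr0 addr0.
- by move=> c x y /=; rewrite !fctE lD lE scalerBr opprD addrACA.
- by move=> x y /=; rewrite !fctE mD mE opprD addrACA -mulrBl -mulrBr.
Qed.
HB.instance Definition _ := GRing.isZmodClosed.Build (A -> A) is_derivation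
  is_derivation_zmod.
HB.instance Definition _ := [SubChoice_isSubZmodule of Der by <:].

Fact scale_is_derivation (f : A) (D : Der) : is_derivation (fun x => f * D x).
Proof.
apply/asboolP; split=> [c x y|x y]; first by rewrite linearP mulrDr scalerAr.
by rewrite DerM mulrDr mulrA [f * (x * _)]mulrCA.
Qed.
Definition Der_scale (f : A) (D : Der) : Der := MkDer (scale_is_derivation f D).

Fact Der_scaleA f g D : Der_scale f (Der_scale g D) = Der_scale (f * g) D.
Proof. by apply: DerP => x /=; rewrite mulrA. Qed.
Fact Der_scale1 : left_id 1 Der_scale.
Proof. by move=> D; apply: DerP => x /=; rewrite mul1r. Qed.
Fact Der_scaleDr : right_distributive Der_scale +%R.
Proof. by move=> f D E; apply: DerP => x /=; rewrite -mulrDr. Qed.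
Fact Der_scaleDl D : {morph Der_scale^~ D : f g / f + g}.
Proof. by move=> f g; apply: DerP => x /=; rewrite mulrDl. Qed.
HB.instance Definition _ := GRing.Zmodule_isLmodule.Build A Der
  Der_scaleA Der_scale1 Der_scaleDr Der_scaleDl.

Lemma Der_scaleE f (D : Der) x : (f *: D) x = f * D x.
Proof. by []. Qed.
Lemma Der_addE (D E : Der) x : (D + E) x = D x + E x.
Proof. by []. Qed.
Lemma Der_oppE (D : Der) x : (- D) x = - D x.
Proof. by []. Qed.

Fact lie_is_derivation (D E : Der) : is_derivation (fun x => D (E x) - E (D x)).
Proof.
apply/asboolP; split=> [c x y|x y].
  by rewrite !linearP /= addrACA -scalerDr.
by rewrite !DerM !linearD /= !DerM; ring.
Qed.
Definition lie (D E : Der) : Der := MkDer (lie_is_derivation D E).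

Lemma lieE D E x : lie D E x = D (E x) - E (D x).
Proof. by []. Qed.

Lemma lie_alt D : lie D D = 0.
Proof. by apply: DerP => x; rewrite lieE subrr. Qed.

Lemma lie_linear_l E c D D' :
  lie (c%:A *: D + D') E = c%:A *: lie D E + lie D' E.
Proof.
apply: DerP => x; rewrite !(lieE, Der_addE, Der_scaleE) linearD /=.
by rewrite !mulr_algl linearZ /= scalerBr opprD addrACA.
Qed.

Lemma lie_jacobi D E G :
  lie D (lie E G) + lie E (lie G D) + lie G (lie D E) = 0.
Proof.
apply: DerP => x; rewrite !(Der_addE, lieE) !linearB /=.
by rewrite -[RHS]/(0 : A); ring.
Qed.

Lemma lie_scale (f g : A) (D : Der) :
  lie (f *: D) (g *: D) = (f * D g - g * D f) *: D.
Proof. by apply: DerP => x; rewrite !(lieE, Der_scaleE) !DerM; ring. Qed.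

End Derivations.

Notation "[ 'lie' D , E ]" := (lie D E) (at level 0, D, E at level 99,
  format "[ 'lie'  D ,  E ]").

Section Ra.
Variables (F : fieldType) (n : nat) (a : n.-tuple F).
Local Notation K := (ratfun F).

Definition ratfun_t : K := ratfun_of_poly 'X.

Definition Ra_gen (x : K) : Prop :=
  x = ratfun_t \/ exists i : 'I_n, x = (ratfun_t - (tnth a i)%:A)^-1.

Record Ra := MkRa { Ra_val : K; _ : Ra_val \in subalg Ra_gen }.

HB.instance Definition _ := [isSub for Ra_val].
HB.instance Definition _ := [Choice of Ra by <:].
HB.instance Definition _ := [SubChoice_isSubComNzRing of Ra by <:].
HB.instance Definition _ := [SubZmodule_isSubLmodule of Ra by <:].
HB.instance Definition _ := [SubNzRing_SubLmodule_isSubLalgebra of Ra by <:].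
HB.instance Definition _ := GRing.Lalgebra_isComAlgebra.Build F Ra.

(* The ring inverse of R_a, needed for integer powers x ^ m in R_a; by
   Ra_tB_unit and val_Ra_tB_exp those of t - a_i agree with the ones in F(t). *)
Definition Ra_unit : {pred Ra} :=
  fun x => (val x != 0) && ((val x)^-1 \in subalg Ra_gen).
Definition Ra_inv (x : Ra) : Ra :=
  if Ra_unit x then insubd x (val x)^-1 else x.

Fact Ra_val_inv x : Ra_unit x -> val (Ra_inv x) = (val x)^-1.
Proof. by move=> Ux; rewrite /Ra_inv Ux insubdK //; case/andP: Ux. Qed.
Fact Ra_mulVx : {in Ra_unit, left_inverse 1 Ra_inv *%R}.
Proof.
move=> x Ux; apply: val_inj; change (val (Ra_inv x) * val x = 1).
by rewrite (Ra_val_inv Ux); apply: mulVf; case/andP: Ux.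
Qed.
Fact Ra_unitPl x y : y * x = 1 -> Ra_unit x.
Proof.
move=> /(congr1 val) yx; change (val y * val x = 1) in yx.
have x0 : val x != 0.
  by apply/eqP => x0; move/eqP: yx; rewrite x0 mulr0 eq_sym oner_eq0.
rewrite /Ra_unit x0 /=; suff -> : (val x)^-1 = val y by apply: valP.
by apply: (mulIf x0); rewrite (mulVf x0) yx.
Qed.
Fact Ra_inv_out : {in [predC Ra_unit], Ra_inv =1 id}.
Proof. by move=> x /negbTE Ux; rewrite /Ra_inv [Ra_unit x]Ux. Qed.
HB.instance Definition _ :=
  GRing.ComNzRing_hasMulInverse.Build Ra Ra_mulVx Ra_unitPl Ra_inv_out.

Fact ratfun_t_in_Ra : ratfun_t \in subalg Ra_gen.
Proof. by apply/subalgP/subalg_gen; left. Qed.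
Definition Ra_t : Ra := MkRa ratfun_t_in_Ra.

Definition Ra_tB (i : 'I_n) : Ra := Ra_t - (tnth a i)%:A.

Lemma ratfun_tB_neq0 c : ratfun_t - c%:A != 0.
Proof.
rewrite ratfun_scaleE mulr1 /ratfun_t -rmorphB ratfun_of_poly_eq0.
exact/monic_neq0/monicXsubC.
Qed.

Lemma val_Ra_tB i : val (Ra_tB i) = ratfun_t - (tnth a i)%:A.
Proof. by []. Qed.

Lemma Ra_tB_unit i : Ra_tB i \is a GRing.unit.
Proof.
apply/andP; split; first exact: ratfun_tB_neq0.
by apply/subalgP/subalg_gen; right; exists i.
Qed.

Lemma val_RaV (x : Ra) : x \is a GRing.unit -> val x^-1 = (val x)^-1.
Proof. exact: Ra_val_inv. Qed.

Lemma val_Ra_tB_exp i (m : int) :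
  val (Ra_tB i ^ m) = (ratfun_t - (tnth a i)%:A) ^ m.
Proof.
case: m => m; first exact: rmorphXn.
rewrite !NegzE -!exprnN val_RaV; first by rewrite rmorphXn.
exact/unitrX/Ra_tB_unit.
Qed.

Lemma ratfun_deriv_t : ratfun_deriv ratfun_t = 1.
Proof. by rewrite ratfun_deriv_poly derivX rmorph1. Qed.

Lemma ratfun_deriv1 : ratfun_deriv (1 : K) = 0.
Proof. by rewrite -(rmorph1 (@ratfun_of_poly F)) ratfun_deriv_poly derivC rmorph0. Qed.

Lemma ratfun_deriv_Ra x :
  x \in subalg Ra_gen -> ratfun_deriv x \in subalg Ra_gen.
Proof.
move=> /subalgP; elim=> {x}.
- move=> x [-> | [i ->]]; first by rewrite ratfun_deriv_t; exact: rpred1.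
  rewrite ratfun_derivV linearB linearZ /= ratfun_deriv_t ratfun_deriv1.
  rewrite scaler0 subr0 mulN1r rpredN rpredX //.
  by apply/subalgP/subalg_gen; right; exists i.
- by rewrite ratfun_deriv1; exact: rpred0.
- by move=> c x y _ Dx _ Dy; rewrite linearP; apply: rpredD => //; apply: rpredZ.
move=> x y /subalgP Sx Dx /subalgP Sy Dy.
by rewrite ratfun_derivM; apply: rpredD; apply: rpredM.
Qed.

Definition Ra_deriv (x : Ra) : Ra := MkRa (ratfun_deriv_Ra (valP x)).

Fact Ra_deriv_is_derivation : is_derivation Ra_deriv.
Proof.
apply/asboolP; split=> [c x y|x y]; apply: val_inj => /=.
  exact: ratfun_deriv_is_linear.
exact: ratfun_derivM.
Qed.

(* The bracket of V_a = Der(R_a) is the commutator [lie]; Va_gen and Va_free give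
   Der(R_a) = R_a d/dt, and lie_scale the usual formula for the bracket. *)
Definition Va := Der Ra.
Definition Va_d : Va := MkDer Ra_deriv_is_derivation.

Lemma Va_dE (x : Ra) : val (Va_d x) = ratfun_deriv (val x).
Proof. by []. Qed.

Lemma Va_d_tB i : Va_d (Ra_tB i) = 1.
Proof.
apply: val_inj; rewrite Va_dE val_Ra_tB linearB linearZ /= ratfun_deriv_t.
by rewrite ratfun_deriv1 scaler0 subr0.
Qed.

Lemma Va_free (f : Ra) : f *: Va_d = 0 -> f = 0.
Proof.
move=> /(congr1 (fun D : Va => D Ra_t)); rewrite Der_scaleE.
suff -> : Va_d Ra_t = 1 by rewrite mulr1.
by apply: val_inj; rewrite Va_dE ratfun_deriv_t.
Qed.

Lemma Va_gen (D : Va) : D = D Ra_t *: Va_d.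
Proof.
apply/eqP; rewrite -subr_eq0; apply/eqP; set E : Va := D - _.
have Et : E Ra_t = 0.
  rewrite /E Der_addE Der_oppE Der_scaleE.
  have -> : Va_d Ra_t = 1 by apply: val_inj; rewrite Va_dE ratfun_deriv_t.
  by rewrite mulr1 subrr.
move: E Et => {D} E Et.
apply: DerP => -[x Sx].
have /subalgP Gx := Sx; elim: Gx Sx => {x}.
- move=> x [-> | [i xE]] Sx.
    by rewrite (_ : MkRa Sx = Ra_t); last exact: val_inj.
  set y := MkRa Sx.
  have yt : y * Ra_tB i = 1.
    apply: val_inj; change (x * val (Ra_tB i) = 1).
    by rewrite xE val_Ra_tB; apply/mulVf/ratfun_tB_neq0.
  have EtB : E (Ra_tB i) = 0 by rewrite DerB DerZ Et Der1 scaler0 subr0.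
  have := DerM E y (Ra_tB i); rewrite yt Der1 EtB mulr0 addr0 => /esym/eqP.
  by rewrite mulIr_eq0; [move/eqP|exact/mulIr/Ra_tB_unit].
- by move=> Sx; rewrite (_ : MkRa Sx = 1) ?Der1; last exact: val_inj.
- move=> c x y /subalgP Sx Ex /subalgP Sy Ey Sxy.
  rewrite (_ : MkRa Sxy = c *: MkRa Sx + MkRa Sy); last exact: val_inj.
  by rewrite DerD DerZ Ex Ey scaler0 addr0.
- move=> x y /subalgP Sx Ex /subalgP Sy Ey Sxy.
  rewrite (_ : MkRa Sxy = MkRa Sx * MkRa Sy); last exact: val_inj.
  by rewrite DerM Ex Ey mul0r mulr0 addr0.
Qed.

End Ra.

(* Main.v *)
(* Everything reduces to identities in R_a, since D(x ^ m) = m x ^ (m - 1) when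
   D x = 1.  For (a), expand t - a_i = (t - a_j) + (a_j - a_i) by the binomial
   theorem.  For (b), set u = t - a_i, v = t - a_j and d = v - u = a_i - a_j.
   The partial fraction decomposition of u ^ (- k) v ^ (- l) is obtained by
   induction from
     d u ^ (- k - 1) v ^ (- l - 1) = u ^ (- k - 1) v ^ (- l) - u ^ (- k) v ^ (- l - 1),
   which on the coefficients is Pascal's rule, and the bracket is a combination of
   two such decompositions. *)

Require Import Defs.
From mathcomp Require Import all_boot all_order all_algebra.
From mathcomp Require Import reals complex.
From mathcomp Require Import ring zify.
Import GRing.Theory.
Local Open Scope ring_scope.

Lemma Der_exprz (F : comNzRingType) (A : comUnitAlgType F) (D : Der A) (x : A) (m : int) :
  x \is a GRing.unit -> D (x ^ m) = m%:~R * x ^ (m - 1) * D x.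
Proof.
move=> Ux; have xS i : x ^ i = x ^ (i - 1) * x.
  by rewrite -[x in RHS]expr1z -exprzDr // subrK.
elim/int_ind: m => [|n IHn|n IHn]; first by rewrite expr0z Der1 !mul0r.
  have -> : n.+1%:Z = n%:Z + 1 by rewrite -addn1 PoszD.
  rewrite addrK exprzDr // expr1z DerM IHn intrD.
  by rewrite [in X in _ + X]xS [x ^ n%:Z]xS; ring.
have E : - n%:Z = - n.+1%:Z + 1 by lia.
(* The Leibniz rule for [x ^ (- n.+1) * x = x ^ (- n)] is solved for the derivative of the first
   factor. *)
apply: (mulIr Ux); have := DerM D (x ^ (- n.+1%:Z)) x.
rewrite -[x in D (_ * x)]expr1z -exprzDr // -E IHn => /esym/(canRL (addrK _)) ->.
have -> : (- n.+1%:Z)%:~R = (- n%:Z)%:~R - 1 :> A by rewrite E intrD addrK.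
have -> : - n%:Z - 1 = - n.+1%:Z by lia.
by rewrite [x ^ (- n.+1%:Z)]xS; ring.
Qed.

Lemma lie_exprz (F : comNzRingType) (A : comUnitAlgType F) (D : Der A) (x y : A) (p q : int) :
    x \is a GRing.unit -> y \is a GRing.unit -> D x = 1 -> D y = 1 ->
  [lie x ^ p *: D, y ^ q *: D] =
  (q%:~R * (x ^ p * y ^ (q - 1)) - p%:~R * (x ^ (p - 1) * y ^ q)) *: D.
Proof.
move=> Ux Uy Dx Dy; rewrite lie_scale !Der_exprz // Dx Dy !mulr1.
by congr (_ *: _); ring.
Qed.

Lemma lie_exprn_exprz (F : fieldType) (A : comUnitAlgType F) (D : Der A)
    (e : F) (u v : A) (k : nat) (m : int) :
    u \is a GRing.unit -> v \is a GRing.unit -> D u = 1 -> D v = 1 ->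
    u = v + e%:A -> (0 < k)%N ->
  [lie u ^ k%:Z *: D, v ^ m *: D] =
  \sum_(0 <= s < k.+1)
    (('C(k, s)%:R * (m + s%:Z - k%:Z)%:~R * e ^+ s) *: v ^ (k%:Z + m - s%:Z - 1)) *: D.
Proof.
move=> Uu Uv Du Dv uv; case: k => // k _.
rewrite lie_exprz // -scaler_suml uv; congr (_ *: _).
have -> : k.+1%:Z - 1 = k by lia.
have expD q : (v + e%:A) ^+ q = \sum_(0 <= i < q.+1) v ^+ (q - i) * e%:A ^+ i * 'C(q, i)%:R.
  by rewrite exprDn big_mkord; apply: eq_bigr => i _; rewrite mulr_natr.
(* Padding by the index [k.+1], where the binomial coefficient is 0, gives both expansions the same
   range. *)
have -> : (v + e%:A) ^ k%:Z = \sum_(0 <= i < k.+2) v ^+ (k - i) * e%:A ^+ i * 'C(k, i)%:R.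
  by rewrite big_nat_recr //= bin_small // mulr0 addr0 -exprnP expD.
rewrite -exprnP expD {expD}.
rewrite !mulr_suml !mulr_sumr -sumrB; apply: eq_big_nat => s /andP[_ sk].
have -> : v ^ (k.+1%:Z + m - s%:Z - 1) = v ^+ (k.+1 - s) * v ^ (m - 1).
  by rewrite exprnP -exprzDr //; congr (_ ^ _); lia.
set w := v ^+ (k.+1 - s) * v ^ (m - 1).
(* At [s = k.+1] the truncated exponent [k - s] makes the powers of [v] differ, but both
   coefficients vanish. *)
have H : k.+1%:Z%:~R * 'C(k, s)%:R * (v ^+ (k - s) * v ^ m) =
         (k.+1 - s)%:R * 'C(k.+1, s)%:R * w.
  rewrite -pmulrn; case: (leqP s k) => [sk'|ks]; last first.
    by rewrite bin_small // mulr0 (_ : k.+1 - s = 0)%N ?mul0r; last lia.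
  rewrite -!natrM mul_bin_down /w !exprnP -!exprzDr //; congr (_ * _ ^ _); lia.
have cw c : c *: w = in_alg A c * w by rewrite mulr_algl.
rewrite cw !rmorphM rmorph_nat rmorph_int rmorphXn /=; move: (e%:A) => b.
have -> : (m + s%:Z - k.+1%:Z)%:~R = m%:~R - (k.+1 - s)%:R :> A.
  by rewrite -[(k.+1 - s)%:R]/((k.+1 - s)%:Z%:~R) -intrB; congr (_%:~R); lia.
move: H; rewrite {cw}/w.
move: (v ^+ (k.+1 - s)) (v ^+ (k - s)) (v ^ (m - 1)) (v ^ m) => x y x' y'.
move: (b ^+ s) (k.+1%:Z%:~R) (m%:~R) ((k.+1 - s)%:R) ('C(k.+1, s)%:R) ('C(k, s)%:R) => f p q r c c' H.
transitivity (q * c * f * (x * x') - p * c' * (y * y') * f); first by ring.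
by rewrite H; ring.
Qed.

Section PartialFractions.
Variables (F : fieldType) (A : comUnitAlgType F).
Implicit Types (d : F) (u v : A) (k l r : nat).

(** For [d != 0], the coefficient of [u ^ r] in the expansion of [(u + d) ^ (- l)] at [u = 0]. At
    [l = 0] truncated subtraction gives the correct values 1, 0, 0, ... *)
Definition polar_coef d l r : F := 'C(l + r - 1, r)%:R / (d ^+ l * (- d) ^+ r).

(* The principal part at u = 0 of u ^ (- k) (u + d) ^ (- l). *)
Definition polar_part d l k u : A :=
  \sum_(1 <= p < k.+1) polar_coef d l (k - p) *: u ^ (- p%:Z).

Lemma polar_coefS0 d l : d != 0 -> d * polar_coef d l.+1 0 = polar_coef d l 0.
Proof.
by move=> d0; rewrite /polar_coef !bin0 expr0 exprS; field; rewrite expf_neq0.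
Qed.

(** Compares the coefficients of [u ^ (r + 1)] in [d (u + d) ^ (- l - 1) = (u + d) ^ (- l) - u (u +
    d) ^ (- l - 1)]. *)
Lemma polar_coefSS d l r : d != 0 ->
  d * polar_coef d l.+1 r.+1 = polar_coef d l r.+1 - polar_coef d l.+1 r.
Proof.
move=> d0; rewrite /polar_coef !addSn !addnS !subn1 /= binS natrD !exprS.
by field; rewrite !expf_neq0 ?oppr_eq0 ?d0.
Qed.

Lemma polar_partS d l k u : d != 0 ->
  d *: polar_part d l.+1 k.+1 u = polar_part d l k.+1 u - polar_part d l.+1 k u.
Proof.
(* The pole of order [k.+1] is absent from the last part, so it is split off and left to
   [polar_coefS0]. *)
move=> d0; rewrite /polar_part !(@big_nat_recr _ _ _ k.+1) //=.
rewrite scalerDr addrAC subnn scalerA polar_coefS0 //; congr (_ + _).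
rewrite scaler_sumr -sumrB; apply: eq_big_nat => p /andP[_ pk].
by rewrite subSn // scalerA polar_coefSS // scalerBl.
Qed.

(** Since [v = u + d] and [u = v - d], the part at [v = 0] arises from the one at [u = 0] by
    exchanging the exponents and negating [d]. For [k = l = 0] the left side is 1 but both parts are
    empty. *)
Lemma partial_fractions d u v k l : d != 0 ->
    u \is a GRing.unit -> v \is a GRing.unit -> v - u = d%:A -> (0 < k + l)%N ->
  u ^ (- k%:Z) * v ^ (- l%:Z) = polar_part d l k u + polar_part (- d) k l v.
Proof.
move=> d0 Uu Uv uv.
have polar0 e q w : polar_part e q 0 w = 0 by rewrite /polar_part big_geq.
have polarl e q w : polar_part e 0 q.+1 w = w ^ (- q.+1%:Z).
  rewrite /polar_part big_nat_recr //= subnn big_nat big1 => [|p /andP[_ pq]].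
    by rewrite add0r /polar_coef bin0 !expr0 mulr1 divr1 scale1r.
  rewrite /polar_coef subSn // bin_small ?mul0r ?scale0r //; lia.
elim: k l => [|k IHk] l; first by case: l => // l _; rewrite mul1r polar0 polarl add0r.
elim: l => [|l IHl] _; first by rewrite mulr1 polar0 polarl addr0.
have xS (w : A) i : w \is a GRing.unit -> w * w ^ (- i.+1%:Z) = w ^ (- i%:Z).
  by move=> Uw; rewrite -[w in w * _]expr1z -exprzDr //; congr (_ ^ _); lia.
have d0' : - d != 0 by rewrite oppr_eq0.
have := @polar_partS _ k l v d0'; rewrite scaleNr => /(canRL opprK) Ev.
(* The four parts regroup into the decompositions for [(k.+1, l)] and [(k, l.+1)], given by the
   inner and the outer induction. *)
apply: (scalerI d0); rewrite scalerDr polar_partS // Ev opprB addrACA -IHl ?addSn //.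
rewrite -opprD -IHk ?addnS // -mulr_algl -uv.
by rewrite -(xS u k) // -(xS v l) //; ring.
Qed.

(** This is the principal part at [u = 0] of the bracket coefficient [k u ^ (- k - 1) v ^ (- l) - l
    u ^ (- k) v ^ (- l - 1)]. *)
Lemma polar_part_lie d k l u : (0 < l)%N -> d != 0 ->
  k%:R * polar_part d l k.+1 u - l%:R * polar_part d l.+1 k u =
  \sum_(1 <= p < k.+2)
     ((2 * k + 1 - p)%N%:R * 'C(k + l - p, k + 1 - p)%:R
          / (d ^+ l * (- d) ^+ (k + 1 - p))) *: u ^ (- p%:Z).
Proof.
move=> l0 d0; rewrite /polar_part !(@big_nat_recr _ _ _ k.+1) //= mulrDr addrAC.
congr (_ + _); last first.
  rewrite mulr_natl -scaler_nat scalerA /polar_coef; congr (_ *: _).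
  rewrite !addn1 !subnn !bin0 expr0 mulr1 mul1r mulr1; congr (_%:R / _); lia.
rewrite !mulr_sumr -sumrB; apply: eq_big_nat => p /andP[p0 pk].
rewrite ![_ * (_ *: _)]mulr_natl -!scaler_nat !scalerA -scalerBl; congr (_ *: _).
rewrite /polar_coef; set r := (k - p)%N.
have -> : (k.+1 - p = r.+1)%N by lia.
have -> : (k + 1 - p = r.+1)%N by lia.
have -> : (l + r.+1 - 1 = l + r)%N by lia.
have -> : (l.+1 + r - 1 = l + r)%N by lia.
have -> : (k + l - p = l + r)%N by lia.
have -> : (2 * k + 1 - p = k + r.+1)%N by lia.
(* Over the common denominator [d ^+ l * (- d) ^+ r.+1] the two terms add up, and this identity
   merges them into the factor [k + r.+1]. *)
have H : r.+1%:R * 'C(l + r, r.+1)%:R = l%:R * 'C(l + r, r)%:R :> F.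
  by rewrite -!natrM mul_bin_left addnK.
rewrite natrD mulrDl H !exprS.
by field; rewrite !expf_neq0 ?oppr_eq0 ?d0.
Qed.

Lemma lie_exprzN (D : Der A) (x y : F) u v k l :
    u \is a GRing.unit -> v \is a GRing.unit -> D u = 1 -> D v = 1 ->
    x - y != 0 -> v - u = (x - y)%:A -> (0 < k)%N -> (0 < l)%N ->
  [lie u ^ (- k%:Z) *: D, v ^ (- l%:Z) *: D] =
  \sum_(1 <= p < k.+2)
     (((2 * k + 1 - p)%N%:R * 'C(k + l - p, k + 1 - p)%:R
          / ((x - y) ^+ l * (y - x) ^+ (k + 1 - p))) *: u ^ (- p%:Z)) *: D
  - \sum_(1 <= p < l.+2)
     (((2 * l + 1 - p)%N%:R * 'C(l + k - p, l + 1 - p)%:R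
          / ((y - x) ^+ k * (x - y) ^+ (l + 1 - p))) *: v ^ (- p%:Z)) *: D.
Proof.
rewrite -[y - x]opprB; move: (x - y) => d Uu Uv Du Dv d0 uv k0 l0.
have d0' : - d != 0 by rewrite oppr_eq0.
rewrite lie_exprz // -!scaler_suml -scalerBl; congr (_ *: _).
have E q : - q%:Z - 1 = - q.+1%:Z by lia.
rewrite !E !(partial_fractions _ _ _ _ _ d0 Uu Uv uv); try lia.
(* The part at [v = 0] is the same combination with [k], [l] exchanged and [d] negated; the exchange
   reverses its sign, hence the minus between the sums. *)
have := polar_part_lie d k l u l0 d0; have := polar_part_lie (- d) l k v k0 d0'.
rewrite opprK => <- <-; rewrite !intrN -!pmulrn; ring.
Qed.

End PartialFractions.

Theorem theorem2 (R : realType) (n : nat) (a : n.-tuple R[i])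
    (a_uniq : uniq a) (k l : nat) (k_gt0 : (0 < k)%N) (l_gt0 : (0 < l)%N)
    (m : int) (i j : 'I_n) (i_neq_j : i != j) :
  (* (a) *)
  [lie Ra_tB a i ^ k%:Z *: Va_d a, Ra_tB a j ^ m *: Va_d a] =
    \sum_(0 <= s < k.+1)
      (('C(k, s)%:R * (m + s%:Z - k%:Z)%:~R * (tnth a j - tnth a i) ^+ s)
         *: Ra_tB a j ^ (k%:Z + m - s%:Z - 1)) *: Va_d a
  /\
  (* (b) *)
  [lie Ra_tB a i ^ (- k%:Z) *: Va_d a, Ra_tB a j ^ (- l%:Z) *: Va_d a] =
    \sum_(1 <= p < k.+2)
      (((2 * k + 1 - p)%N%:R * 'C(k + l - p, k + 1 - p)%:R
          / ((tnth a i - tnth a j) ^+ l * (tnth a j - tnth a i) ^+ (k + 1 - p)))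
         *: Ra_tB a i ^ (- p%:Z)) *: Va_d a
    - \sum_(1 <= p < l.+2)
      (((2 * l + 1 - p)%N%:R * 'C(l + k - p, l + 1 - p)%:R
          / ((tnth a j - tnth a i) ^+ k * (tnth a i - tnth a j) ^+ (l + 1 - p)))
         *: Ra_tB a j ^ (- p%:Z)) *: Va_d a.
Proof.
have ij : tnth a i - tnth a j != 0.
  by rewrite subr_eq0; apply: contraNneq i_neq_j => /tuple_uniqP ->.
have Ui := Ra_tB_unit a i; have Uj := Ra_tB_unit a j.
have Di := Va_d_tB a i; have Dj := Va_d_tB a j.
have E (t : Ra a) (x y : R[i]) : t - y%:A = t - x%:A + (x - y)%:A.
  by rewrite scalerBl addrA subrK.
have Eji : Ra_tB a j - Ra_tB a i = (tnth a i - tnth a j)%:A.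
  by rewrite /Ra_tB (E _ (tnth a i)) addrC addKr.
split; first exact: (lie_exprn_exprz _ _ _ _ _ _ _ _ Ui Uj Di Dj (E _ _ _)).
exact: (lie_exprzN _ _ _ _ _ _ _ _ _ Ui Uj Di Dj ij Eji).
Qed.
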